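(* Let $p\ge 2$ and $\beta\in(2,3)$. Then there is a constant $C>0$ such that for every $t\in[0,T]$, $x\in\mathbb{T}$ and $h>0$, $$\mathbf{E}\bigl|Y(t,x+h)-Y(t,x)\bigr|^{p}\le C\,h^{\frac{2p}{\beta}} .$$
   Context: Fix $T>0$. $\mathbb{T}=\mathbb{R}/\mathbb{Z}$ is the one-dimensional flat torus, identified with $[0,1)$ with periodic boundary conditions. $p_t(x)=\sum_{k\in\mathbb{Z}}\frac{1}{\sqrt{4\pi t}}e^{-(x-k)^2/(4t)}$ is the periodic heat kernel. $W$ is a space-time Gaussian white noise on $[0,T]\times\mathbb{T}$, i.e. a centered Gaussian family with $\mathbf{E}[W(A)W(B)]=\lambda(A\cap B)$ for Borel $A,B\subset[0,T]\times\mathbb{T}$, $\lambda$ being Lebesgue measure. Let $f(u)=u-u^3$, and let $u$ be the unique mild solution, with zero initial condition, of the stochastic Allen--Cahn equation $\partial_t u=\partial_x^2u+f(u)+\dot W$ on $[0,T]\times\mathbb{T}$, i.e. $$u(t,x)=\int_0^t\!\int_{\mathbb{T}}p_{t-s}(x-y)f(u(s,y))\,dy\,ds+\int_0^t\!\int_{\mathbb{T}}p_{t-s}(x-y)\,W(ds,dy);$$ it satisfies $\sup_{t\in[0,T],x\in\mathbb{T}}\mathbf{E}|u(t,x)|^q<\infty$ for all $q\ge2$. Put $$Y(t,x)=\int_0^t\!\int_{\mathbb{T}}p_{t-s}(x-y)f(u(s,y))\,dy\,ds .$$ *)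

(* Defs.v *)
From HB Require Import structures.
From mathcomp Require Import all_boot all_order all_algebra.
From mathcomp Require Import all_classical all_reals all_analysis.

Set Implicit Arguments.
Unset Strict Implicit.
Unset Printing Implicit Defensive.

Import Order.TTheory GRing.Theory Num.Theory.
Import numFieldNormedType.Exports.

Local Open Scope classical_set_scope.
Local Open Scope ring_scope.

(* The torus R/Z is represented by [0, 1[: random fields and sets on
   [0, t] x R/Z live on [space_time t].  A real x outside [0, 1[ stands for its
   class mod 1; this is only ever fed to [heat_kernel], which is 1-periodic
   (lemma [heat_kernelD1]). *)
Definition space_time (R : realType) (t : R) : set (R * R) :=
  `[0, t]%classic `*` `[0, 1[%classic.

Notation lebesgue2 R :=
  (@lebesgue_measure R \x @lebesgue_measure R)%E (only parsing).

(* For t <= 0 the square root vanishes, so that heat_kernel t x = 0. *)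
Definition heat_kernel (R : realType) (t x : R) : R :=
  fine (\esum_(k in [set: int])
    ((Num.sqrt (4 * pi * t))^-1 * expR (- (x - k%:~R) ^+ 2 / (4 * t)))%:E)%E.

Lemma heat_kernelD1 (R : realType) (t x : R) :
  heat_kernel t (x + 1) = heat_kernel t x.
Proof.
rewrite /heat_kernel (@reindex_esum _ _ _ setT setT (fun k : int => k + 1)).
  by under eq_esum do rewrite intrD opprD addrACA subrr addr0.
split=> // [k l _ _ /addIr//|k _].
by exists (k - 1) => //; rewrite subrK.
Qed.

Definition allen_cahn (R : realType) (v : R) : R := v - v ^+ 3.

(* [normal_prob m 0] is not the Dirac mass at m, hence the case s = 0. *)
Definition gaussian_law (R : realType) (m s : R) (B : set R) : \bar R :=
  if s == 0 then \d_m B else normal_prob m s B.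

Definition centered_gaussian (d : measure_display) (Omega : measurableType d)
    (R : realType) (P : probability Omega R) (X : Omega -> R) : Prop :=
  measurable_fun [set: Omega] X /\
  exists2 s : R, 0 <= s &
    forall B : set R, measurable B -> P (X @^-1` B) = gaussian_law 0 s B.

Definition borel_in (R : realType) (E A : set (R * R)) : Prop :=
  measurable A /\ A `<=` E.

(* The family (W A) is (jointly) Gaussian: every finite linear combination is
   Gaussian. *)
Definition white_noise (d : measure_display) (Omega : measurableType d)
    (R : realType) (P : probability Omega R) (T : R)
    (W : set (R * R) -> Omega -> R) : Prop :=
  (forall (n : nat) (a : 'I_n -> R) (A : 'I_n -> set (R * R)),
     (forall i, borel_in (space_time T) (A i)) ->
     centered_gaussian P (fun w => \sum_(i < n) a i * W (A i) w)) /\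
  (forall A B : set (R * R),
     borel_in (space_time T) A -> borel_in (space_time T) B ->
     'E_P[fun w => (W A w * W B w)%R] = (lebesgue2 R) (A `&` B))%E.

(* A list of pairs (a, A) encodes the simple function sum a 1_A, whose
   integral against W is sum a W(A). *)
Definition simple_eval (R : realType) (g : seq (R * set (R * R)))
    (z : R * R) : R := \sum_(c <- g) c.1 * \1_(c.2) z.

Definition simple_noise (Omega : Type) (R : realType)
    (W : set (R * R) -> Omega -> R) (g : seq (R * set (R * R)))
    (w : Omega) : R := \sum_(c <- g) c.1 * W c.2 w.

(* X is a version of the Wiener integral of phi over E against W, i.e. the
   value at phi of the isometric extension of sum a 1_A |-> sum a W(A) to
   L^2(E). *)
Definition wiener_integral (d : measure_display) (Omega : measurableType d)
    (R : realType) (P : probability Omega R) (W : set (R * R) -> Omega -> R)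
    (E : set (R * R)) (phi : R * R -> R) (X : Omega -> R) : Prop :=
  [/\ measurable_fun E phi, measurable_fun [set: Omega] X &
    exists g : nat -> seq (R * set (R * R)),
      [/\ forall n c, c \in g n -> borel_in E c.2,
          (fun n => \int[lebesgue2 R]_(z in E)
             ((simple_eval (g n) z - phi z) ^+ 2)%:E)%E @ \oo --> 0%E &
          (fun n => 'E_P[fun w => ((simple_noise W (g n) w - X w) ^+ 2)%R])%E
            @ \oo --> 0%E]].

Definition drift_integrand (Omega : Type) (R : realType)
    (u : R -> R -> Omega -> R) (t x : R) (w : Omega) (z : R * R) : R :=
  heat_kernel (t - z.1) (x - z.2) * allen_cahn (u z.1 z.2 w).

Definition drift (Omega : Type) (R : realType)
    (u : R -> R -> Omega -> R) (t x : R) (w : Omega) : R :=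
  \int[lebesgue2 R]_(z in space_time t) drift_integrand u t x w z.

(* The initial condition u(0, x) = 0 is the equation at t = 0. *)
Definition mild_solution (d : measure_display) (Omega : measurableType d)
    (R : realType) (P : probability Omega R) (T : R)
    (W : set (R * R) -> Omega -> R) (u : R -> R -> Omega -> R) : Prop :=
  measurable_fun (space_time T `*` [set: Omega])
    (fun z : (R * R) * Omega => u z.1.1 z.1.2 z.2) /\
  forall t x : R, space_time T (t, x) ->
    {ae P, forall w, (lebesgue2 R).-integrable (space_time t)
                       (EFin \o drift_integrand u t x w)} /\
    exists2 Z : Omega -> R,
      wiener_integral P W (space_time t)
        (fun z => heat_kernel (t - z.1) (x - z.2)) Z &
      {ae P, forall w, u t x w = drift u t x w + Z w}.

(* Main.v *)
Require Import Defs.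
From HB Require Import structures.
From mathcomp Require Import all_boot all_order all_algebra.
From mathcomp Require Import all_classical all_reals all_analysis.
From mathcomp Require Import measurable_realfun.
From mathcomp Require Import ring lra.

Set Implicit Arguments.
Unset Strict Implicit.
Unset Printing Implicit Defensive.

Import Order.TTheory GRing.Theory Num.Theory.
Import numFieldNormedType.Exports.

Local Open Scope classical_set_scope.
Local Open Scope ring_scope.

(**
The difference Y(t, x + h) - Y(t, x) is the integral over space-time of
k(s, y) f(u(s, y)), where k(s, y) = p_(t-s)(x + h - y) - p_(t-s)(x - y) is
deterministic and, by the moment hypothesis, f(u(s, y)) has a p-th moment
bounded by a constant M for all (s, y), as |f(u)|^p is at most a multiple of
|u|^p + |u|^(3p).  Jensen's inequality for the measure |k| ds dy and Tonelli's
theorem bound the p-th moment of such an integral by M m^p as soon as m bounds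
the integral of |k| ([moment_integral_le]).  So everything reduces to the L^1
norm of k, a statement about the heat kernel alone
([integral_drift_kernel_dist]): it is at most 2 t and at most
6 h t^(1/2).  The first bound serves for h >= 1, the second for h <= 1, and
since 2 / beta lies in [0, 1] both are dominated by a multiple of h^(2/beta)
([min_le_powR]).

For the L^1 norm of k, unfolding the circle to the line
([ge0_integral_periodize]) replaces the periodic kernel by the Gaussian
density g_r, r = t - s.  The L^1 distance of two densities is controlled by
their Hellinger affinity, that is by the integral of their geometric mean,
and the geometric mean of two translates of g_r at distance h is
exp (- h^2 / (16 r)) times a third translate.  Hence the distance is at most
lam (1 - e) + (1 + e) / lam with e = exp (- h^2 / (16 r)), for every lam > 0
([integral_gauss_dist]): lam = 1 gives 2 and lam = r^(1/2) / h gives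
3 h r^(-1/2), which is integrable in r at 0 ([integral_inv_sqrt_le]).
*)

(** * Unfolding the circle to the line *)

Lemma lebesgue_measure_shift (R : realType) (c : R) (A : set R) :
  measurable A ->
  pushforward lebesgue_measure (fun x : R => x + c : measurableTypeR R) A =
  lebesgue_measure A.
Proof.
move=> mA; apply/esym/lebesgue_measure_unique => //=.
  by apply: measurable_funD.
move=> ? _ [[a b]] _ <-.
rewrite /pushforward.
have -> : (fun x : R => x + c) @^-1` `]a, b] = `]a - c, b - c]%classic.
  by apply/seteqP; split => x /=; rewrite !in_itv/= ltrBlDr lerBrDr.
rewrite !lebesgue_measure_itv/= !lte_fin ltrD2r.
by case: ifP => // _; rewrite -!EFinB; congr (_%:E); ring.
Qed.

Lemma ge0_integral_shift (R : realType) (c : R) (D : set R) (f : R -> \bar R) :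
  measurable D -> measurable_fun D f -> (forall x, D x -> 0 <= f x)%E ->
  (\int[lebesgue_measure]_(x in (fun y => y + c)%R @^-1` D) f (x + c)%R =
   \int[lebesgue_measure]_(x in D) f x)%E.
Proof.
move=> mD mf f0.
pose phi : measurableTypeR R -> measurableTypeR R := fun y => y + c.
have mphi : measurable_fun setT phi by exact: measurable_funD.
rewrite -[LHS](@ge0_integral_pushforward _ _ _ _ _ phi mphi lebesgue_measure D
  f mD mf); last by move=> y /set_mem; exact: f0.
by apply: eq_measure_integral => //= A mA _; exact: lebesgue_measure_shift.
Qed.

Lemma nat_int_bij : exists e : nat -> int, set_bij [set: nat] [set: int] e.
Proof.
exists (fun n => if odd n then Negz n./2 else Posz n./2); split=> //.
- move=> m n _ _; case: ifP => om; case: ifP => on // [h];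
    by rewrite -(odd_double_half m) -(odd_double_half n) om on h.
- move=> [n|n] _; [exists n.*2 | exists n.*2.+1] => //=.
  + by rewrite odd_double doubleK.
  + by rewrite odd_double/= uphalf_double.
Qed.

Lemma esum_int_nneseries (R : realType) (e : nat -> int) (a : int -> \bar R) :
  set_bij [set: nat] [set: int] e -> (forall k, 0 <= a k)%E ->
  (\esum_(k in [set: int]) a k = \sum_(0 <= n <oo) a (e n))%E.
Proof.
by move=> be a0; rewrite (reindex_esum _ _ _ _ be) nneseries_esumT.
Qed.

(** The translates of [0, 1[ by the integers tile the line, so that integrating
    a periodization over the circle is integrating over the line. *)
Lemma ge0_integral_periodize (R : realType) (f : R -> \bar R) :
  measurable_fun [set: R] f -> (forall x, 0 <= f x)%E ->
  (\int[lebesgue_measure]_(x in `[0%R, 1%R[)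
     (\esum_(k in [set: int]) f (x + k%:~R)%R) =
   \int[lebesgue_measure]_x f x)%E.
Proof.
move=> mf f0; have [e be] := nat_int_bij.
under eq_integral do rewrite (esum_int_nneseries be)//.
rewrite integral_nneseries//; last first.
  by move=> n; apply: measurableT_comp => //; exact: measurable_funD.
pose J (n : nat) : set R := `[(e n)%:~R, (e n)%:~R + 1[%classic.
have IE : [set: R] = \bigcup_n J n.
  apply/seteqP; split=> // x _.
  have [_ _ /(_ (Num.floor x) I)[n _ en]] := be; exists n => //=.
  by rewrite /J/= in_itv/= en -[1]/(1%:~R) -intrD floor_itv.
have tI : trivIset [set: nat] J.
  apply/trivIsetP => m n _ _ mn; apply/seteqP; split=> // x [] /=.
  rewrite /J/= !in_itv/= => /andP[xm1 xm2] /andP[xn1 xn2].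
  have [_ inj _] := be.
  apply/negP: mn; rewrite negbK; apply/eqP/inj; rewrite ?in_setT//.
  apply/eqP; rewrite eq_le -!ltzD1 -!(ltr_int R) !intrD.
  by rewrite (le_lt_trans xm1 xn2) (le_lt_trans xn1 xm2).
rewrite IE ge0_integral_bigcup//=; last 2 first.
- by move=> n; exact: measurable_itv.
- by rewrite -IE.
apply: eq_eseriesr => n _.
rewrite -(@ge0_integral_shift _ (e n)%:~R (J n))//; last first.
- exact: measurable_funS mf.
- exact: measurable_itv.
suff -> : `[0, 1[%classic = (fun y => y + (e n)%:~R) @^-1` J n by [].
by apply/seteqP; split=> x; rewrite /J/= !in_itv/= lerDr [_ + 1]addrC ltrD2r.
Qed.

(** * L^1 distance between translates of a Gaussian density *)

(** The density of the centered normal law of variance 2 r for r > 0.  For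
    r <= 0 it is 0, as the square root is then 0. *)
Definition gauss (R : realType) (r x : R) : R :=
  (Num.sqrt (4 * pi * r))^-1 * expR (- x ^+ 2 / (4 * r)).

Lemma gauss_ge0 (R : realType) (r x : R) : 0 <= gauss r x.
Proof. by rewrite mulr_ge0 ?expR_ge0// invr_ge0 sqrtr_ge0. Qed.

(** The identity 1 / x = x (x^2)^(-1) holds at 0 too, and the last factor is a
    real power of a nonnegative number, a measurable function of it. *)
Lemma measurable_inv (R : realType) : measurable_fun [set: R] (@GRing.inv R).
Proof.
have -> : @GRing.inv R = fun x => x * (x ^+ 2) `^ (-1).
  apply/funext => x; rewrite powR_inv1 ?sqr_ge0//.
  have [->|x0] := eqVneq x 0; first by rewrite mul0r invr0.
  by field.
apply: measurable_funM => //.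
exact: (measurableT_comp (measurable_powR (-1)) (exprn_measurable _)).
Qed.

Lemma measurable_inv_sqrt (R : realType) (d : measure_display)
    (X : measurableType d) (f : X -> R) :
  measurable_fun [set: X] f ->
  measurable_fun [set: X] (fun x => (Num.sqrt (f x))^-1).
Proof.
move=> mf; apply: (measurableT_comp (@measurable_inv R)).
have msqrt := continuous_measurable_fun (@sqrt_continuous R).
exact: (measurableT_comp msqrt).
Qed.

Lemma measurable_gauss (R : realType) (d : measure_display)
    (X : measurableType d) (r f : X -> R) :
  measurable_fun [set: X] r -> measurable_fun [set: X] f ->
  measurable_fun [set: X] (fun x => gauss (r x) (f x)).
Proof.
move=> mr mf; apply: measurable_funM.
  by apply: measurable_inv_sqrt; exact: measurable_funM.
apply: (measurableT_comp (@measurable_expR R)).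
apply: measurable_funM.
  by apply: measurableT_comp => //; exact: measurable_funX.
apply: (measurableT_comp (@measurable_inv R)).
exact: measurable_funM.
Qed.

Lemma integral_gauss (R : realType) (r a : R) : 0 < r ->
  (\int[lebesgue_measure]_y (gauss r (a - y))%:E = 1)%E.
Proof.
move=> r0; pose s := Num.sqrt (2 * r).
have s2 : s ^+ 2 = 2 * r by rewrite sqr_sqrtr// mulr_ge0// ltW.
have s0 : s != 0 by rewrite sqrtr_eq0 -ltNge mulr_gt0.
rewrite -[RHS](integral_normal_pdf a s); apply: eq_integral => y _.
rewrite normal_pdfE// /normal_peak /normal_fun /gauss s2; congr (_%:E).
have -> : 2 * r * pi *+ 2 = 4 * pi * r by ring.
have -> : 2 * r *+ 2 = 4 * r by ring.
by rewrite -(opprB a y) sqrrN.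
Qed.

(** Completing the square: a^2 + b^2 = 2 ((a + b) / 2)^2 + (a - b)^2 / 2, so
    that the geometric mean of two translates of a Gaussian is a multiple of the
    translate half-way. *)
Lemma gauss_mul (R : realType) (r a b : R) :
  gauss r a * gauss r b =
  (expR (- (a - b) ^+ 2 / (16 * r)) * gauss r ((a + b) / 2)) ^+ 2.
Proof.
have expE : expR (- a ^+ 2 / (4 * r)) * expR (- b ^+ 2 / (4 * r)) =
    (expR (- (a - b) ^+ 2 / (16 * r)) *
     expR (- ((a + b) / 2) ^+ 2 / (4 * r))) ^+ 2.
  rewrite -!expRD -expRM_natl; congr expR.
  have [->|r0] := eqVneq r 0; first by rewrite !mulr0 invr0 !mulr0 addr0 mulr0.
  by field.
by rewrite /gauss mulrACA expE; ring.
Qed.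

(** With u and v the square roots of the two densities, |u^2 - v^2| is
    |u - v| (u + v), at most lam (u - v)^2 / 2 + (u + v)^2 / (2 lam).  The
    products u v are given by [gauss_mul]; they are spread over the two sides so
    that both are nonnegative and can be integrated separately. *)
Lemma gauss_dist_le (R : realType) (lam r a b : R) : 0 < lam ->
  `|gauss r a - gauss r b| +
    lam * (expR (- (a - b) ^+ 2 / (16 * r)) * gauss r ((a + b) / 2)) <=
  (lam + lam^-1) / 2 * (gauss r a + gauss r b) +
    lam^-1 * (expR (- (a - b) ^+ 2 / (16 * r)) * gauss r ((a + b) / 2)).
Proof.
move=> lam0.
set e := _ * gauss r ((a + b) / 2).
pose u := Num.sqrt (gauss r a); pose v := Num.sqrt (gauss r b).
have u0 : 0 <= u by exact: sqrtr_ge0.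
have v0 : 0 <= v by exact: sqrtr_ge0.
have uE : gauss r a = u ^+ 2 by rewrite sqr_sqrtr// gauss_ge0.
have vE : gauss r b = v ^+ 2 by rewrite sqr_sqrtr// gauss_ge0.
have eE : e = u * v.
  rewrite -sqrtrM ?gauss_ge0// gauss_mul sqrtr_sqr ger0_norm//.
  by rewrite mulr_ge0 ?expR_ge0 ?gauss_ge0.
rewrite uE vE eE subr_sqr normrM [`|u + v|]ger0_norm ?addr_ge0//.
set d := `|u - v|.
have d2 : d ^+ 2 = (u - v) ^+ 2 by rewrite real_normK// num_real.
rewrite -subr_ge0.
have -> : (lam + lam^-1) / 2 * (u ^+ 2 + v ^+ 2) + lam^-1 * (u * v) -
   (d * (u + v) + lam * (u * v)) =
   (lam^-1 / 2) * (lam * d - (u + v)) ^+ 2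
   + lam / 2 * ((u - v) ^+ 2 - d ^+ 2).
  by field; rewrite gt_eqF.
by rewrite d2 subrr mulr0 addr0 mulr_ge0 ?sqr_ge0// divr_ge0// invr_ge0 ltW.
Qed.

Lemma integral_gauss_dist (R : realType) (lam r a b : R) : 0 < r -> 0 < lam ->
  (\int[lebesgue_measure]_y (`|gauss r (a - y) - gauss r (b - y)|)%:E <=
   (lam * (1 - expR (- (a - b) ^+ 2 / (16 * r))) +
    lam^-1 * (1 + expR (- (a - b) ^+ 2 / (16 * r))))%:E)%E.
Proof.
move=> r0 lam0; set e := expR _.
have e0 : 0 <= e by exact: expR_ge0.
have mg x : measurable_fun [set: R] (fun y : R => gauss r (x - y)).
  by apply: measurable_gauss => //; exact: measurable_funB.
have mge (k x : R) : measurable_fun [set: R]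
    (fun y => (k%:E * (gauss r (x - y))%:E)%E).
  by apply: emeasurable_funM => //; exact/measurable_EFinP.
have ig (k x : R) : 0 <= k ->
    (\int[lebesgue_measure]_y (k%:E * (gauss r (x - y))%:E) = k%:E)%E.
  move=> k0; rewrite ge0_integralZl_EFin//; last 2 first.
  - by move=> y _; rewrite lee_fin gauss_ge0.
  - by apply/measurable_EFinP; exact: mg.
  by rewrite integral_gauss// mule1.
have g0 (k x y : R) : 0 <= k -> (0 <= k%:E * (gauss r (x - y))%:E)%E.
  by move=> k0; rewrite -EFinM lee_fin mulr_ge0 ?gauss_ge0.
have k0 : 0 <= (lam + lam^-1) / 2.
  by rewrite divr_ge0// addr_ge0// ?invr_ge0 ltW.
have l0 : 0 <= lam^-1 * e by rewrite mulr_ge0// invr_ge0 ltW.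
have L0 : 0 <= lam * e by rewrite mulr_ge0// ltW.
have mdist : measurable_fun [set: R]
    (fun y => (`|gauss r (a - y) - gauss r (b - y)|)%:E).
  apply/measurable_EFinP; apply: measurableT_comp => //.
  exact: measurable_funB.
have := @ge0_le_integral _ _ _ (@lebesgue_measure R) setT measurableT
  (fun y => (`|gauss r (a - y) - gauss r (b - y)|)%:E +
            (lam * e)%:E * (gauss r ((a + b) / 2 - y))%:E)%E
  (fun y => (((lam + lam^-1) / 2)%:E * (gauss r (a - y))%:E +
             ((lam + lam^-1) / 2)%:E * (gauss r (b - y))%:E) +
            (lam^-1 * e)%:E * (gauss r ((a + b) / 2 - y))%:E)%E.
rewrite !ge0_integralD// ?ig//; try (exact: mge);
  try (by apply: emeasurable_funD; exact: mge);
  try (by move=> y _; rewrite ?adde_ge0// g0).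
move=> H.
have {H} : (\int[lebesgue_measure]_y (`|gauss r (a - y) - gauss r (b - y)|)%:E +
  (lam * e)%:E <= ((lam + lam^-1) + lam^-1 * e)%:E)%E.
  apply: le_trans (H _ _ _ _) _.
  - by move=> y _; rewrite adde_ge0// g0.
  - by apply: emeasurable_funD => //; exact: mge.
  - by do 2?[apply: emeasurable_funD]; exact: mge.
  - move=> y _; rewrite -!EFinM -!EFinD lee_fin -mulrDr.
    have := gauss_dist_le r (a - y) (b - y) lam0.
    have -> : a - y - (b - y) = a - b by ring.
    have -> : (a - y + (b - y)) / 2 = (a + b) / 2 - y by field.
    by rewrite !mulrA.
  - by rewrite -!EFinD lee_fin; lra.
rewrite -leeBrDr//; move/le_trans; apply.
by rewrite -EFinB lee_fin; lra.
Qed.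

(** * L^1 distance between translates of the heat kernel *)

Lemma measurable_esum_int (R : realType) (d : measure_display)
    (X : measurableType d) (f : int -> X -> \bar R) :
  (forall k, measurable_fun [set: X] (f k)) -> (forall k x, 0 <= f k x)%E ->
  measurable_fun [set: X] (fun x => (\esum_(k in [set: int]) f k x)%E).
Proof.
move=> mf f0; have [e be] := nat_int_bij.
under eq_fun do rewrite (esum_int_nneseries be)//.
by apply: ge0_emeasurable_sum => //.
Qed.

(** If only one of the two sums is infinite then so is the sum of the
    distances, and if both are then [fine] sends both to 0; so the bound holds
    for all nonnegative families. *)
Lemma fine_esum_dist (R : realType) (I : choiceType) (a b : I -> R) :
  (forall k, 0 <= a k) -> (forall k, 0 <= b k) ->
  ((`|fine (\esum_(k in [set: I]) (a k)%:E) -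
      fine (\esum_(k in [set: I]) (b k)%:E)|%R)%:E <=
   \esum_(k in [set: I]) (`|a k - b k|%R)%:E)%E.
Proof.
move=> a0 b0.
set A := esum _ (fun k => (a k)%:E); set B := esum _ (fun k => (b k)%:E).
set S := esum _ _.
have le_add (u v : I -> R) : (forall k, 0 <= u k) -> (forall k, 0 <= v k) ->
    (\esum_(k in [set: I]) (u k)%:E <= (\esum_(k in [set: I]) (v k)%:E) +
       \esum_(k in [set: I]) (`|u k - v k|%R)%:E)%E.
  move=> u0 v0; rewrite -esumD; last 2 first.
  - by move=> k _; rewrite lee_fin.
  - by move=> k _; rewrite lee_fin.
  apply: le_esum => k _; rewrite -EFinD lee_fin.
  by have := ler_norm (u k - v k); lra.
have AB : (A <= B + S)%E by exact: le_add.
have BA : (B <= A + S)%E.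
  apply: (le_trans (le_add b a b0 a0)); rewrite leeD2l//.
  by apply: le_esum => k _; rewrite distrC.
have A0 : (0 <= A)%E by apply: esum_ge0 => k _; rewrite lee_fin.
have B0 : (0 <= B)%E by apply: esum_ge0 => k _; rewrite lee_fin.
have S0 : (0 <= S)%E by apply: esum_ge0 => k _; rewrite lee_fin.
case: S S0 AB BA => [s| |]// s0 AB BA; last by rewrite leey.
case: A A0 AB BA => [x| |]//; case: B B0 => [y| |]//= y0 x0 AB BA.
  by move: AB BA; rewrite -!EFinD !lee_fin ler_norml; lra.
by rewrite subrr normr0.
Qed.

Lemma heat_kernelE (R : realType) (r x : R) :
  heat_kernel r x = fine (\esum_(k in [set: int]) (gauss r (x - k%:~R))%:E)%E.
Proof. by []. Qed.

Lemma heat_kernel0 (R : realType) (x : R) : heat_kernel 0 x = 0.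
Proof.
by rewrite heat_kernelE esum1// => k _; rewrite /gauss mulr0 sqrtr0 invr0 mul0r.
Qed.

Lemma heat_kernelDz (R : realType) (r x : R) (k : int) :
  heat_kernel r (x + k%:~R) = heat_kernel r x.
Proof.
have Dn (n : nat) (y : R) : heat_kernel r (y + n%:R) = heat_kernel r y.
  by elim: n => [|n IHn]; rewrite ?addr0// -natr1 addrA heat_kernelD1.
case: k => n; first by rewrite -pmulrn Dn.
by rewrite NegzE mulrNz -pmulrn -(Dn n.+1) subrK.
Qed.

Lemma measurable_heat_kernel (R : realType) (d : measure_display)
    (X : measurableType d) (r f : X -> R) :
  measurable_fun [set: X] r -> measurable_fun [set: X] f ->
  measurable_fun [set: X] (fun x => heat_kernel (r x) (f x)).
Proof.
move=> mr mf; apply: (measurableT_comp (fine_measurable measurableT)).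
apply: measurable_esum_int => [k|k x]; last by rewrite lee_fin gauss_ge0.
apply/measurable_EFinP; apply: measurable_gauss => //.
exact: measurable_funB.
Qed.

Lemma integral_heat_kernel_dist (R : realType) (lam r a b : R) :
  0 < r -> 0 < lam ->
  (\int[lebesgue_measure]_(y in `[0%R, 1%R[)
     (`|heat_kernel r (a - y) - heat_kernel r (b - y)|)%:E <=
   (lam * (1 - expR (- (a - b) ^+ 2 / (16 * r))) +
    lam^-1 * (1 + expR (- (a - b) ^+ 2 / (16 * r))))%:E)%E.
Proof.
move=> r0 lam0; apply: le_trans (integral_gauss_dist _ _ r0 lam0).
have mB x (k : R) : measurable_fun [set: R] (fun y : R => x - y - k).
  by apply: measurable_funB => //; exact: measurable_funB.
have mB' x : measurable_fun [set: R] (fun y : R => x - y).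
  exact: measurable_funB.
rewrite -ge0_integral_periodize//; last first.
  apply/measurable_EFinP; apply: measurableT_comp => //.
  by apply: measurable_funB; apply: measurable_gauss.
apply: ge0_le_integral => //.
- apply/measurable_EFinP; apply: measurableT_comp => //.
  by apply: measurable_funTS; apply: measurable_funB;
    apply: measurable_heat_kernel => //; exact: mB'.
- apply: measurable_funTS; apply: measurable_esum_int => // k.
  apply/measurable_EFinP; apply: measurableT_comp => //.
  apply: measurable_funB; apply: measurable_gauss => //;
    by apply: measurable_funB => //; exact: measurable_funD.
- move=> y _; rewrite !heat_kernelE.
  apply: le_trans (fine_esum_dist _ _) _ => [k|k|].
  + exact: gauss_ge0.
  + exact: gauss_ge0.
  by apply: le_esum => k _; rewrite !opprD !addrA.
Qed.

Lemma integral_heat_kernel_dist_le2 (R : realType) (r a b : R) : 0 <= r ->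
  (\int[lebesgue_measure]_(y in `[0%R, 1%R[)
     (`|heat_kernel r (a - y) - heat_kernel r (b - y)|)%:E <= 2%:E)%E.
Proof.
rewrite le_eqVlt => /predU1P[<-|r0].
  under eq_integral do rewrite !heat_kernel0 subrr normr0.
  by rewrite integral0 lee_fin.
apply: (le_trans (integral_heat_kernel_dist a b r0 ltr01)).
by rewrite lee_fin invr1 !mul1r; lra.
Qed.

(** This is the bound of [integral_heat_kernel_dist] at lam = r^(1/2) / |a - b|,
    where 1 - exp (- x) <= x makes the first term of order |a - b| r^(-1/2),
    like the second.  At r = 0 both sides vanish. *)
Lemma integral_heat_kernel_dist_sqrt (R : realType) (r a b : R) : 0 <= r ->
  (\int[lebesgue_measure]_(y in `[0%R, 1%R[)
     (`|heat_kernel r (a - y) - heat_kernel r (b - y)|)%:E <=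
   (3 * `|a - b| * (Num.sqrt r)^-1)%:E)%E.
Proof.
rewrite le_eqVlt => /predU1P[<-|r0].
  under eq_integral do rewrite !heat_kernel0 subrr normr0.
  by rewrite integral0 sqrtr0 invr0 mulr0.
have [->|ab] := eqVneq a b.
  under eq_integral do rewrite subrr normr0.
  by rewrite integral0 subrr normr0 mulr0 mul0r.
set s := Num.sqrt r; have s0 : 0 < s by rewrite sqrtr_gt0.
have rE : r = s ^+ 2 by rewrite sqr_sqrtr// ltW.
set h := `|a - b|; have h0 : 0 < h by rewrite normr_gt0 subr_eq0.
have hE : (a - b) ^+ 2 = h ^+ 2 by rewrite real_normK// num_real.
have lam0 : 0 < s / h by rewrite divr_gt0.
apply: (le_trans (integral_heat_kernel_dist a b r0 lam0)).
rewrite lee_fin hE.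
set x := h ^+ 2 / (16 * r); have x0 : 0 <= x.
  by rewrite divr_ge0 ?sqr_ge0// mulr_ge0// ltW.
rewrite mulNr -/x.
have e1 : 1 - expR (- x) <= x by have := expR_ge1Dx (- x); lra.
have e2 : expR (- x) <= 1 by rewrite -expR0 ler_expR; lra.
(* The constant 1 / 16 + 2 is rounded up to 3, which leaves the last summand. *)
have -> : 3 * h * s^-1 = s / h * x + (s / h)^-1 * 2 + 15 / 16 * (h / s).
  by rewrite /x rE; field; rewrite !gt_eqF.
rewrite -[leLHS]addr0 !lerD//.
- by rewrite ler_wpM2l// ltW.
- by rewrite ler_wpM2l ?invr_ge0 ?(ltW lam0)//; lra.
- by rewrite mulr_ge0// ?divr_ge0// ltW.
Qed.

(** * Integrating the singularity in time *)

(** The integrand blows up at s = t, so the fundamental theorem of calculus is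
    applied on [0, b] for b < t, with a bound that does not depend on b, and b
    then increases to t. *)
Lemma integral_inv_sqrt_le (R : realType) (t : R) : 0 <= t ->
  (\int[lebesgue_measure]_(s in `[0%R, t]) ((Num.sqrt (t - s))^-1)%:E <=
   (2 * Num.sqrt t)%:E)%E.
Proof.
rewrite le_eqVlt => /predU1P[<-|t0].
  by rewrite set_itv1 integral_set1 sqrtr0 mulr0.
pose f s := (Num.sqrt (t - s))^-1.
pose F s := - (2 * Num.sqrt (t - s)).
have f0 s : 0 <= f s by rewrite invr_ge0 sqrtr_ge0.
have dF s : s < t -> is_derive s 1 F (f s).
  move=> st; have ts0 : 0 < t - s by rewrite subr_gt0.
  have h1 : is_derive (t - s) 1 Num.sqrt (2 * Num.sqrt (t - s))^-1.
    exact: is_derive1_sqrt.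
  have h2 : is_derive s 1 (fun x : R => t - x) (- 1).
    by apply: is_derive_eq; rewrite add0r mul1r.
  have h3 : is_derive s 1 (fun x => Num.sqrt (t - x))
      ((2 * Num.sqrt (t - s))^-1 * - 1) by exact: is_derive1_comp.
  have h4 : is_derive s 1 F (- (2 *: ((2 * Num.sqrt (t - s))^-1 * - 1))).
    exact: (is_deriveN (is_deriveZ 2 h3)).
  apply: (is_derive_eq h4).
  rewrite /f /GRing.scale/= invfM; field.
  by rewrite sqrtr_eq0 -ltNge.
have cf (s : R) : s < t -> {for s, continuous f}.
  move=> st; apply: cvgV.
    by rewrite sqrtr_eq0 -ltNge subr_gt0.
  apply: (@continuous_comp _ _ _ (fun s => t - s) Num.sqrt).
    by apply: cvgB; [exact: cvg_cst|exact: cvg_id].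
  exact: sqrt_continuous.
have mf : measurable_fun [set: R] f.
  by apply: measurable_inv_sqrt; exact: measurable_funB.
have le_cut b : 0 < b -> b < t ->
    (\int[lebesgue_measure]_(s in `[0%R, b]) (f s)%:E <= (2 * Num.sqrt t)%:E)%E.
  move=> b0 bt; rewrite (@continuous_FTC2 _ _ F)//.
  - rewrite -EFinB lee_fin /F subr0 opprK gerDr oppr_le0.
    by rewrite mulr_ge0// sqrtr_ge0.
  - apply: continuous_in_subspaceT => s /set_mem /=.
    rewrite in_itv/= => /andP[_ sb].
    by apply: cf; exact: le_lt_trans bt.
  - have cF s : s < t -> {for s, continuous F}.
      move=> st; apply: differentiable_continuous; apply/derivable1_diffP.
      by have [] := dF _ st.
    split.
    + move=> s; rewrite in_itv/= => /andP[_ sb].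
      by have [] := dF _ (lt_trans sb bt).
    + by apply: cvg_at_right_filter; exact: cF.
    + by apply: cvg_at_left_filter; exact: cF.
  - move=> s; rewrite in_itv/= => /andP[_ sb].
    by rewrite derive1E; have [] := dF _ (lt_trans sb bt).
pose G (n : nat) : set R := `[0, t - t / n.+2%:R]%classic.
have n0 (n : nat) : 0 < t / n.+2%:R by rewrite divr_gt0.
have nt (n : nat) : t / n.+2%:R < t.
  by rewrite ltr_pdivrMr// ltr_pMr// ltr1n.
have GE : `[0, t[%classic = \bigcup_n G n.
  apply/seteqP; split=> s /=.
    rewrite in_itv/= => /andP[s0 st].
    have ts0 : 0 < t - s by rewrite subr_gt0.
    exists (Num.truncn (t / (t - s))) => //; rewrite /G/= in_itv/= s0/=.
    rewrite lerBrDl -lerBrDr ler_pdivrMr// mulrC -ler_pdivrMr//.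
    apply/ltW; apply: (lt_trans (truncnS_gt _)).
    by rewrite ltr_nat.
  move=> [n _]; rewrite /G/= !in_itv/= => /andP[-> sn]/=.
  by rewrite (le_lt_trans sn)// ltrBlDr ltrDl.
rewrite -integral_itv_bndo_bndc; last exact/measurable_EFinP/measurable_funTS.
rewrite GE.
have Gcvg : (\int[lebesgue_measure]_(s in G n) (f s)%:E)%E @[n --> \oo] -->
    (\int[lebesgue_measure]_(s in \bigcup_n G n) (f s)%:E)%E.
  apply: ge0_nondecreasing_set_cvg_integral.
  - move=> m n mn; apply/subsetPset => s.
    rewrite /G/= !in_itv/= => /andP[-> sm]/=.
    rewrite (le_trans sm)// lerD2l lerN2 ler_pM2l// lef_pV2 ?posrE// ler_nat.
    by rewrite !ltnS.
  - by move=> n; exact: measurable_itv.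
  - by move=> n; apply/measurable_EFinP; exact: measurable_funTS.
  - by move=> n s _; rewrite lee_fin.
rewrite -(cvg_lim _ Gcvg)//; apply: lime_le; first exact: cvgP Gcvg.
by apply: nearW => n; apply: le_cut; rewrite ?subr_gt0// ltrBlDr ltrDl.
Qed.

(** * Measurability and integration on products *)

Lemma ge0_integral_setX (R : realType) (d1 d2 : measure_display)
    (X : measurableType d1) (Y : measurableType d2)
    (m1 : {sigma_finite_measure set X -> \bar R})
    (m2 : {sigma_finite_measure set Y -> \bar R})
    (A : set X) (B : set Y) (f : X * Y -> \bar R) :
  measurable A -> measurable B -> measurable_fun (A `*` B) f ->
  (forall z, 0 <= f z)%E ->
  (\int[m1 \x m2]_(z in A `*` B) f z =
   \int[m1]_(x in A) \int[m2]_(y in B) f (x, y))%E.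
Proof.
move=> mA mB mf f0.
have mAB : measurable (A `*` B) by exact: measurableX.
rewrite integral_mkcond fubini_tonelli1; last 2 first.
- exact/(measurable_restrictT _ mAB).
- by move=> z; rewrite patchE; case: ifP.
rewrite [RHS]integral_mkcond; apply: eq_integral => x _.
rewrite /fubini_F patchE; case: ifPn => xA.
  rewrite [RHS]integral_mkcond; apply: eq_integral => y _.
  by rewrite !patchE in_setX/= xA.
rewrite integral0_eq// => y _.
by rewrite patchE in_setX/= (negbTE xA).
Qed.

(** Tonelli's theorem gives the measurability of the integrals of the positive
    and negative parts, hence of their difference. *)
Lemma measurable_integral_param (d1 d2 : measure_display)
    (X : measurableType d1) (Omega : measurableType d2) (R : realType)
    (mu : {sigma_finite_measure set X -> \bar R}) (A : set X)
    (f : X * Omega -> \bar R) :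
  measurable A -> measurable_fun (A `*` [set: Omega]) f ->
  measurable_fun [set: Omega] (fun w => \int[mu]_(z in A) f (z, w))%E.
Proof.
move=> mA mf.
have mAO : measurable (A `*` [set: Omega]) by exact: measurableX.
pose g := f \_ (A `*` [set: Omega]).
have mg : measurable_fun [set: X * Omega] g.
  exact/(measurable_restrictT _ mAO).
have gE w : (\int[mu]_(z in A) f (z, w) =
    \int[mu]_z (g^\+ (z, w))%E - \int[mu]_z (g^\- (z, w))%E)%E.
  rewrite integral_mkcond.
  have -> : (fun z => f (z, w)) \_ A = (fun z => g (z, w)).
    by apply/funext => z; rewrite /g !patchE in_setX/= in_setT andbT.
  by rewrite integralE; congr (_ - _)%E; apply: eq_integral => z _;
    rewrite ?funeposE ?funenegE.
under eq_fun do rewrite gE.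
apply: emeasurable_funB.
  apply: (@measurable_fun_fubini_tonelli_G _ _ _ _ _ mu (g^\+)%E) => //.
  exact: measurable_funepos.
apply: (@measurable_fun_fubini_tonelli_G _ _ _ _ _ mu (g^\-)%E) => //.
exact: measurable_funeneg.
Qed.

Lemma measurable_fun_sectionl (d1 d2 : measure_display)
    (X : measurableType d1) (Omega : measurableType d2) (R : realType)
    (A : set X) (v : X * Omega -> R) (w : Omega) :
  measurable A -> measurable_fun (A `*` [set: Omega]) v ->
  measurable_fun A (fun z => v (z, w)).
Proof.
move=> mA /(measurable_restrictT _ (measurableX mA measurableT)).
move=> /(measurable_fun_pair1 w) mv; apply/(measurable_restrictT _ mA).
apply: eq_measurable_fun mv => z _.
by rewrite !patchE in_setX/= in_setT andbT.
Qed.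

Lemma measurable_fun_sectionr (d1 d2 : measure_display)
    (X : measurableType d1) (Omega : measurableType d2) (R : realType)
    (A : set X) (v : X * Omega -> R) (z : X) :
  measurable A -> measurable_fun (A `*` [set: Omega]) v -> A z ->
  measurable_fun [set: Omega] (fun w => v (z, w)).
Proof.
move=> mA /(measurable_restrictT _ (measurableX mA measurableT)).
move=> /(measurable_fun_pair2 z) mv Az; apply: eq_measurable_fun mv => w _.
by rewrite patchE mem_set.
Qed.

(** * The kernel of the increments on space-time *)

Lemma sigma_finite_lebesgue2 (R : realType) : sigma_finite setT (lebesgue2 R).
Proof.
pose J n : set (measurableTypeR R) := `[- n%:R, n%:R]%classic.
exists (fun n => J n `*` J n).
  apply/seteqP; split=> // -[a b] _.
  pose r := Num.max `|a| `|b|.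
  have rT : r <= (Num.truncn r).+1%:R by rewrite ltW// truncnS_gt.
  exists (Num.truncn r).+1 => //; split; rewrite /J/= in_itv/= -ler_norml;
    by apply: le_trans rT; rewrite le_max lexx ?orbT.
move=> n; have mJ : measurable (J n) by exact: measurable_itv.
split; first exact: measurableX.
have Joo : (lebesgue_measure (J n) < +oo)%E.
  by rewrite /J lebesgue_measure_itv/=; case: ifP; rewrite -?EFinB ltry.
by rewrite product_measure1E// lte_mul_pinfty// ge0_fin_numE.
Qed.

(** Packs sigma-finiteness explicitly, so that space-time can itself be a factor
    in an application of Tonelli's theorem. *)
Definition sigma_finite_lebesgue2_measure (R : realType) :
    {sigma_finite_measure set (measurableTypeR R * measurableTypeR R)%type -> \bar R} :=
  HB.pack_for (sigma_finite_measure (measurableTypeR R * measurableTypeR R)%type R)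
    (lebesgue2 R)
    (Measure_isSigmaFinite.Build _ _ _ (lebesgue2 R) (sigma_finite_lebesgue2 R)).

Lemma measurable_space_time (R : realType) (t : R) : measurable (space_time t).
Proof. by apply: measurableX; exact: measurable_itv. Qed.

Lemma measurable_drift_kernel (R : realType) (t x : R) (D : set (R * R)) :
  measurable_fun D (fun z => heat_kernel (t - z.1) (x - z.2)).
Proof.
by apply: measurable_funTS; apply: measurable_heat_kernel;
  apply: measurable_funB.
Qed.

(** At each time s the integral over the circle is at most 2 and at most
    3 |a - b| (t - s)^(-1/2), also at s = t where both kernels vanish; these two
    bounds are integrated over [0, t]. *)
Lemma integral_drift_kernel_dist (R : realType) (t a b : R) : 0 <= t ->
  (\int[lebesgue2 R]_(z in space_time t)
     (`|heat_kernel (t - z.1) (a - z.2) - heat_kernel (t - z.1) (b - z.2)|)%:E <=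
   (Num.min (2 * t) (6 * `|a - b| * Num.sqrt t))%:E)%E.
Proof.
move=> t0.
pose f (z : R * R) : \bar R :=
  (`|heat_kernel (t - z.1) (a - z.2) - heat_kernel (t - z.1) (b - z.2)|)%:E.
have mf D : measurable_fun D f.
  apply/measurable_EFinP; apply: measurableT_comp => //.
  by apply: measurable_funB; exact: measurable_drift_kernel.
have f0 z : (0 <= f z)%E by rewrite lee_fin.
have mF : measurable_fun `[0, t]%classic
    (fun s => \int[lebesgue_measure]_(y in `[0%R, 1%R[) f (s, y))%E.
  apply: measurable_funTS.
  apply: (@measurable_integral_param _ _ _ _ _ lebesgue_measure `[0, 1[%classic
    (fun z => f (z.2, z.1))) => //.
  apply: measurable_funTS.
  exact: (measurableT_comp (mf setT) (@measurable_swap _ _ _ _)).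
have F0 s : (0 <= \int[lebesgue_measure]_(y in `[0%R, 1%R[) f (s, y))%E.
  by apply: integral_ge0.
have msq : measurable_fun [set: R] (fun s => (Num.sqrt (t - s))^-1).
  by apply: measurable_inv_sqrt; exact: measurable_funB.
have ts s : `[0, t]%classic s -> 0 <= t - s.
  by move=> /=; rewrite in_itv/= subr_ge0 => /andP[].
rewrite /space_time ge0_integral_setX//; last exact: mf.
rewrite EFin_min le_min; apply/andP; split.
- apply: (@le_trans _ _ (\int[lebesgue_measure]_(s in `[0%R, t]) (cst 2%:E s))%E).
    apply: ge0_le_integral => //; first by move=> s _; exact: F0.
    by move=> s /ts ts0; exact: (integral_heat_kernel_dist_le2 a b ts0).
  rewrite integral_cst//= lebesgue_measure_itv/= lte_fin.
  by case: ifPn => _; rewrite ?mule0 ?sube0 -?EFinM lee_fin// mulr_ge0.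
- apply: (@le_trans _ _ (\int[lebesgue_measure]_(s in `[0%R, t])
     ((3 * `|a - b|)%:E * ((Num.sqrt (t - s))^-1)%:E))%E).
    apply: ge0_le_integral => //.
    + by move=> s _; exact: F0.
    + by apply: emeasurable_funM => //; exact/measurable_EFinP/measurable_funTS.
    + by move=> s /ts ts0; exact: (integral_heat_kernel_dist_sqrt a b ts0).
  rewrite ge0_integralZl_EFin//; last first.
    exact/measurable_EFinP/measurable_funTS.
  have -> : 6 * `|a - b| * Num.sqrt t = 3 * `|a - b| * (2 * Num.sqrt t) by ring.
  by rewrite [leRHS]EFinM lee_wpmul2l ?lee_fin ?mulr_ge0// integral_inv_sqrt_le.
Qed.

(** * Moments of an integral against a deterministic kernel *)

(** The convex function v |-> v^p lies above its tangent at c; this form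
    follows from Young's inequality. *)
Lemma powR_tangent (R : realType) (p v c : R) : 1 < p -> 0 <= v -> 0 <= c ->
  p * c `^ (p - 1) * v <= v `^ p + (p - 1) * c `^ p.
Proof.
move=> p1 v0 c0; have p0 : 0 < p by lra.
have q0 : 0 < p / (p - 1) by rewrite divr_gt0// subr_gt0.
have pq : p^-1 + (p / (p - 1))^-1 = 1 by field; rewrite !gt_eqF// subr_gt0.
have := conjugate_powR v0 (powR_ge0 c (p - 1)) p0 q0 pq.
rewrite -powRrM (_ : (p - 1) * (p / (p - 1)) = p); last first.
  by field; rewrite gt_eqF// subr_gt0.
rewrite -(ler_pM2l p0) mulrDr => h.
rewrite -mulrA [_ * v]mulrC (le_trans h)// le_eqVlt; apply/orP; left; apply/eqP.
by field; rewrite !gt_eqF// subr_gt0.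
Qed.

(** Jensen's inequality for the measure k mu, of total mass at most m.  The
    tangent inequality at c = D / m is integrated against k; with D = c m the
    result is c^p m <= I, where I is the integral of k v^p, and
    D^p = m^(p-1) c^p m. *)
Lemma powR_integral_le (d : measure_display) (X : measurableType d)
    (R : realType) (mu : {measure set X -> \bar R}) (A : set X) (k v : X -> R)
    (p m D : R) :
  measurable A -> measurable_fun A k -> measurable_fun A v ->
  (forall z, 0 <= k z) -> (forall z, 0 <= v z) ->
  1 < p -> 0 < m -> 0 <= D ->
  (\int[mu]_(z in A) (k z)%:E <= m%:E)%E ->
  (D%:E <= \int[mu]_(z in A) (k z * v z)%:E)%E ->
  ((D `^ p)%:E <= (m `^ (p - 1))%:E * \int[mu]_(z in A) (k z * v z `^ p)%:E)%E.
Proof.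
move=> mA mk mv k0 v0 p1 m0 D0 km Dkv.
set I := (\int[mu]_(z in A) (k z * v z `^ p)%:E)%E.
pose c := D / m.
have c0 : 0 <= c by rewrite divr_ge0// ltW.
have DE : D = c * m by rewrite /c divfK// gt_eqF.
have p0 : 0 < p by lra.
have p10 : 0 < p - 1 by lra.
have mvp : measurable_fun A (fun z => v z `^ p).
  exact: (measurableT_comp (measurable_powR p)).
have cp0 : 0 <= (p - 1) * c `^ p by rewrite mulr_ge0 ?powR_ge0// ltW.
have cp1 : 0 <= p * c `^ (p - 1) by rewrite mulr_ge0 ?powR_ge0// ltW.
have : ((p * c `^ (p - 1))%:E * \int[mu]_(z in A) (k z * v z)%:E <=
    I + ((p - 1) * c `^ p)%:E * \int[mu]_(z in A) (k z)%:E)%E.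
  rewrite -!ge0_integralZl_EFin//; last 4 first.
  - by move=> z _; rewrite lee_fin.
  - exact/measurable_EFinP.
  - by move=> z _; rewrite lee_fin mulr_ge0.
  - by apply/measurable_EFinP; exact: measurable_funM.
  rewrite -ge0_integralD//; last 4 first.
  - by move=> z _; rewrite lee_fin mulr_ge0 ?powR_ge0.
  - by apply/measurable_EFinP; exact: measurable_funM.
  - by move=> z _; rewrite -EFinM lee_fin mulr_ge0.
  - by apply: emeasurable_funM => //; exact/measurable_EFinP.
  apply: ge0_le_integral => //.
  - by move=> z _; rewrite -EFinM lee_fin mulr_ge0// mulr_ge0.
  - apply: emeasurable_funM => //; apply/measurable_EFinP; exact: measurable_funM.
  - apply: emeasurable_funD.
      by apply/measurable_EFinP; exact: measurable_funM.
    by apply: emeasurable_funM => //; exact/measurable_EFinP.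
  - move=> z _; rewrite -!EFinM -EFinD lee_fin.
    rewrite mulrCA [_ * k z]mulrC -mulrDr ler_wpM2l//.
    exact: powR_tangent.
move=> H.
have {H} : ((p * c `^ (p - 1) * D)%:E <= I + ((p - 1) * c `^ p * m)%:E)%E.
  rewrite !EFinM; apply: (le_trans _ (le_trans H _)).
    by rewrite lee_wpmul2l// lee_fin.
  by rewrite leeD2l// lee_wpmul2l// lee_fin.
rewrite -leeBlDr// -EFinB.
have -> : p * c `^ (p - 1) * D - (p - 1) * c `^ p * m = c `^ p * m.
  by rewrite -(mulr_powRB1 c0 p0) DE; ring.
move=> H.
have -> : D `^ p = m `^ (p - 1) * (c `^ p * m).
  rewrite DE powRM// ?ltW// -(mulr_powRB1 (ltW m0) p0); ring.
by rewrite EFinM lee_wpmul2l// lee_fin powR_ge0.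
Qed.

(** Jensen's inequality bounds |D|^p by m^(p-1) times the integral of |k| |v|^p,
    and Tonelli's theorem moves the expectation inside that integral, where it
    is at most M. *)
Lemma moment_integral_le (d1 d2 : measure_display) (X : measurableType d1)
    (Omega : measurableType d2) (R : realType)
    (mu : {sigma_finite_measure set X -> \bar R}) (P : probability Omega R)
    (A : set X) (k : X -> R) (v : X * Omega -> R) (D : Omega -> R) (p m M : R) :
  measurable A -> measurable_fun A k ->
  measurable_fun (A `*` [set: Omega]) v -> measurable_fun [set: Omega] D ->
  1 < p -> 0 < m -> 0 <= M ->
  (\int[mu]_(z in A) (`|k z|)%:E <= m%:E)%E ->
  (forall z, A z -> 'E_P[fun w => (`|v (z, w)| `^ p)%R] <= M%:E)%E ->
  {ae P, forall w,
    ((`|D w|)%:E <= \int[mu]_(z in A) (`|k z| * `|v (z, w)|)%:E)%E} ->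
  ('E_P[fun w => (`|D w| `^ p)%R] <= (M * m `^ p)%:E)%E.
Proof.
move=> mA mk mv mD p1 m0 M0 km vM Dae.
have mAO : measurable (A `*` [set: Omega]) by exact: measurableX.
have mvp : measurable_fun (A `*` [set: Omega]) (fun z => `|v z| `^ p).
  apply: (measurableT_comp (measurable_powR p)).
  exact: (measurableT_comp (@normr_measurable R setT)).
have mkf : measurable_fun (A `*` [set: Omega]) (fun z => `|k z.1|).
  apply: (measurableT_comp (@normr_measurable R setT)).
  apply: (@measurable_comp _ _ _ _ _ _ A k _ fst) => //.
    by move=> _ [[z w] [/= Az _] <-].
  by apply: measurable_funTS; exact: measurable_fst.
pose g (z : X * Omega) : \bar R := (`|k z.1| * `|v z| `^ p)%:E.
have g0 z : (0 <= g z)%E by rewrite lee_fin mulr_ge0// powR_ge0.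
have mg : measurable_fun (A `*` [set: Omega]) g.
  by apply/measurable_EFinP; exact: measurable_funM.
have mS : measurable_fun [set: Omega] (fun w => \int[mu]_(z in A) g (z, w))%E.
  exact: measurable_integral_param.
have kM : (\int[mu]_(z in A) (M%:E * (`|k z|)%:E) <= (M * m)%:E)%E.
  rewrite ge0_integralZl_EFin//; last first.
    by apply/measurable_EFinP; exact: measurableT_comp.
  by rewrite EFinM lee_wpmul2l// lee_fin.
have SM : (\int[P]_w \int[mu]_(z in A) g (z, w) <= (M * m)%:E)%E.
  pose G := g \_ (A `*` [set: Omega]).
  have mG : measurable_fun [set: X * Omega] G.
    exact/(measurable_restrictT _ mAO).
  have G0 z : (0 <= G z)%E by rewrite /G patchE; case: ifP.
  rewrite (_ : (\int[P]_w _)%E = \int[P]_w \int[mu]_z G (z, w))%E; last first.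
    apply: eq_integral => w _; rewrite integral_mkcond.
    apply: eq_integral => z _.
    by rewrite /G !patchE in_setX/= in_setT andbT.
  rewrite -(@fubini_tonelli _ _ _ _ _ mu P G mG G0); apply: le_trans kM.
  rewrite [leRHS]integral_mkcond; apply: ge0_le_integral => //.
  - by move=> z _; exact: integral_ge0.
  - exact: (@measurable_fun_fubini_tonelli_F _ _ _ _ _ P G mG G0).
  - apply/(measurable_restrictT _ mA); apply: emeasurable_funM => //.
    by apply/measurable_EFinP; exact: measurableT_comp.
  move=> z _; rewrite patchE; case: ifPn => zA; last first.
    by rewrite integral0_eq// => w _; rewrite /G patchE in_setX/= (negbTE zA).
  rewrite muleC; have Az := set_mem zA.
  have -> : (\int[P]_w G (z, w) =
      (`|k z|)%:E * 'E_P[fun w => (`|v (z, w)| `^ p)%R])%E.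
    rewrite unlock -ge0_integralZl_EFin//; last first.
      apply/measurable_EFinP; apply: (measurableT_comp (measurable_powR p)).
      by apply: measurableT_comp => //; exact: measurable_fun_sectionr mv Az.
    by apply: eq_integral => w _; rewrite /G patchE in_setX/= zA in_setT.
  by rewrite lee_wpmul2l ?lee_fin// vM.
have mp0 : 0 <= m `^ (p - 1) by exact: powR_ge0.
rewrite unlock.
apply: (@le_trans _ _ (\int[P]_w ((m `^ (p - 1))%:E * \int[mu]_(z in A) g (z, w)))%E).
  apply: ae_ge0_le_integral => //.
  - apply/measurable_EFinP; apply: (measurableT_comp (measurable_powR p)).
    exact: measurableT_comp.
  - by move=> w _; rewrite mule_ge0 ?lee_fin// integral_ge0.
  - exact: emeasurable_funM.
  - apply: filterS Dae => w Dw _.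
    apply: powR_integral_le => //.
    + exact: measurableT_comp.
    + apply: measurableT_comp => //; exact: measurable_fun_sectionl.
rewrite ge0_integralZl_EFin//; last first.
  by move=> w _; apply: integral_ge0.
have -> : M * m `^ p = m `^ (p - 1) * (M * m).
  by rewrite -(mulr_powRB1 (ltW m0))//; [ring|lra].
by rewrite [leRHS]EFinM lee_wpmul2l// lee_fin.
Qed.

(** * Moments of the nonlinearity *)

Lemma allen_cahn_powR_le (R : realType) (p v : R) : 0 <= p ->
  `|allen_cahn v| `^ p <= 2 `^ p * (`|v| `^ p + `|v| `^ (3 * p)).
Proof.
move=> p0; set a := `|v|; have a0 : 0 <= a by exact: normr_ge0.
have -> : a `^ (3 * p) = (a ^+ 3) `^ p by rewrite powRrM powR_mulrn.
have fv : `|allen_cahn v| <= 2 * Num.max a (a ^+ 3).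
  have h1 : a <= Num.max a (a ^+ 3) by rewrite le_max lexx.
  have h2 : a ^+ 3 <= Num.max a (a ^+ 3) by rewrite le_max lexx orbT.
  by rewrite (le_trans (ler_normB _ _))// normrX -/a; lra.
have mx0 : 0 <= Num.max a (a ^+ 3) by rewrite le_max a0.
apply: (@le_trans _ _ ((2 * Num.max a (a ^+ 3)) `^ p)).
  by apply: ge0_ler_powR => //; rewrite nnegrE// mulr_ge0.
rewrite powRM// ler_wpM2l ?powR_ge0//.
by case: (leP a (a ^+ 3)) => _; rewrite ?lerDl ?lerDr powR_ge0.
Qed.

Lemma allen_cahn_moment_le (d : measure_display) (Omega : measurableType d)
    (R : realType) (P : probability Omega R) (V : Omega -> R) (p M1 M2 : R) :
  0 <= p -> measurable_fun [set: Omega] V ->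
  ('E_P[fun w => (`|V w| `^ p)%R] <= M1%:E)%E ->
  ('E_P[fun w => (`|V w| `^ (3 * p))%R] <= M2%:E)%E ->
  ('E_P[fun w => (`|allen_cahn (V w)| `^ p)%R] <= (2 `^ p * (M1 + M2))%:E)%E.
Proof.
move=> p0 mV V1 V2.
have mpow q (Z : Omega -> R) : measurable_fun [set: Omega] Z ->
    measurable_fun [set: Omega] (fun w => (`|Z w| `^ q)%:E).
  move=> mZ; apply/measurable_EFinP.
  by apply: (measurableT_comp (measurable_powR q)); exact: measurableT_comp.
have mf : measurable_fun [set: Omega] (fun w => allen_cahn (V w)).
  by apply: measurable_funB => //; exact: measurable_funX.
move: V1 V2; rewrite unlock => V1 V2.
apply: (@le_trans _ _ (\int[P]_w ((2 `^ p)%:E *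
    ((`|V w| `^ p)%:E + (`|V w| `^ (3 * p))%:E)))%E).
  apply: ge0_le_integral => //.
  - exact: mpow.
  - by apply: emeasurable_funM => //; apply: emeasurable_funD; exact: mpow.
  - move=> w _; rewrite -EFinD -EFinM lee_fin; exact: allen_cahn_powR_le.
rewrite ge0_integralZl_EFin//; last 2 first.
- by move=> w _; rewrite adde_ge0// lee_fin powR_ge0.
- by apply: emeasurable_funD; exact: mpow.
rewrite EFinM lee_wpmul2l ?lee_fin ?powR_ge0//.
by rewrite ge0_integralD//; [rewrite EFinD leeD|exact: mpow|exact: mpow].
Qed.

(** * Increments of the drift *)

Lemma space_time_subset (R : realType) (s t : R) : s <= t ->
  space_time s `<=` space_time t.
Proof.
move=> st [a b] [/= + ?]; rewrite in_itv/= => /andP[a0 at'].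
by split=> //=; rewrite in_itv/= a0 (le_trans at').
Qed.

Lemma drift_integrandDz (Omega : Type) (R : realType)
    (u : R -> R -> Omega -> R) (t x : R) (k : int) (w : Omega) :
  drift_integrand u t (x + k%:~R) w = drift_integrand u t x w.
Proof.
apply/funext => z; rewrite /drift_integrand.
by rewrite -(heat_kernelDz _ (x - z.2) k) addrAC.
Qed.

(** A mild solution provides integrability for positions in [0, 1[ only; the
    1-periodicity of the heat kernel extends it to all x. *)
Lemma mild_solution_integrable (d : measure_display)
    (Omega : measurableType d) (R : realType) (P : probability Omega R) (T : R)
    (W : set (R * R) -> Omega -> R) (u : R -> R -> Omega -> R) (t x : R) :
  mild_solution P T W u -> 0 <= t <= T ->
  {ae P, forall w, (lebesgue2 R).-integrable (space_time t)
                     (EFin \o drift_integrand u t x w)}.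
Proof.
move=> [_ hu] tT; set y := x - (Num.floor x)%:~R.
have y01 : `[0, 1[%classic y.
  rewrite /= in_itv/= subr_ge0 floor_le/= ltrBlDr addrC -[1]/(1%:~R) -intrD.
  by rewrite floorD1_gt.
have [|+ _] := hu t y; first by split=> //=; rewrite in_itv.
apply: filterS => w; rewrite -(drift_integrandDz _ _ _ (Num.floor x)).
by rewrite subrK.
Qed.

Lemma drift_dist_le (Omega : Type) (R : realType)
    (u : R -> R -> Omega -> R) (t a b : R) (w : Omega) :
  (lebesgue2 R).-integrable (space_time t) (EFin \o drift_integrand u t a w) ->
  (lebesgue2 R).-integrable (space_time t) (EFin \o drift_integrand u t b w) ->
  ((`|drift u t a w - drift u t b w|)%:E <=
   \int[lebesgue2 R]_(z in space_time t)
     (`|heat_kernel (t - z.1) (a - z.2) - heat_kernel (t - z.1) (b - z.2)| *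
      `|allen_cahn (u z.1 z.2 w)|)%:E)%E.
Proof.
move=> ia ib.
have mS : measurable (space_time t : set (measurableTypeR R * measurableTypeR R)).
  exact: measurable_space_time.
rewrite /drift -RintegralB//.
have iab : (lebesgue2 R).-integrable (space_time t)
    (EFin \o (fun z => drift_integrand u t a w z - drift_integrand u t b w z)).
  by have := integrableB mS ia ib; apply: eq_integrable.
apply: (@le_trans _ _ (\int[lebesgue2 R]_(z in space_time t)
    `|(drift_integrand u t a w z - drift_integrand u t b w z)%:E|)%E).
  rewrite -[leLHS]/(`|(fine _)%:E|%E).
  rewrite fineK; last exact: integrable_fin_num.
  apply: le_abse_integral => //.
  by case/integrableP: iab.
rewrite le_eqVlt; apply/orP; left; apply/eqP; apply: eq_integral => z _.
by rewrite abse_EFin /drift_integrand -mulrBl normrM.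
Qed.

Lemma measurable_drift (d : measure_display) (Omega : measurableType d)
    (R : realType) (u : R -> R -> Omega -> R) (t x : R) :
  measurable_fun (space_time t `*` [set: Omega])
    (fun z : (R * R) * Omega => u z.1.1 z.1.2 z.2) ->
  measurable_fun [set: Omega] (drift u t x).
Proof.
move=> mu; apply: (measurableT_comp (fine_measurable measurableT)).
apply: (@measurable_integral_param _ _ _ Omega R
  (sigma_finite_lebesgue2_measure R) (space_time t)
  (fun z => (drift_integrand u t x z.2 z.1)%:E)).
  exact: measurable_space_time.
apply/measurable_EFinP; apply: measurable_funM.
  apply: measurable_funTS.
  apply: measurable_heat_kernel; apply: measurable_funB => //.
    exact: (measurableT_comp measurable_fst measurable_fst).
  exact: (measurableT_comp measurable_snd measurable_fst).
by apply: measurable_funB => //; exact: measurable_funX.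
Qed.

Lemma ereal_sup_bound (R : realType) (I : Type) (A : set I) (f : I -> \bar R) :
  (ereal_sup [set f i | i in A] < +oo)%E ->
  exists2 M : R, 0 <= M & forall i, A i -> (f i <= M%:E)%E.
Proof.
set s := ereal_sup _ => soo.
have fs i : A i -> (f i <= s)%E by move=> Ai; apply: ereal_sup_ubound; exists i.
case: s soo fs => [r| |]// _ fs.
- exists (Num.max 0 r); first by rewrite le_max lexx.
  by move=> i /fs/le_trans; apply; rewrite lee_fin le_max lexx orbT.
- by exists 0 => // i /fs/le_trans; apply; exact: leNye.
Qed.

Lemma min_le_powR (R : realType) (A B K h r : R) :
  0 <= r <= 1 -> 0 < h -> A <= K -> B <= K -> 0 <= K ->
  Num.min A (B * h) <= K * h `^ r.
Proof.
move=> /andP[r0 r1] h0 AK BK K0; rewrite ge_min; apply/orP.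
have [h1|/ltW h1] := leP h 1.
- right; apply: (@le_trans _ _ (K * h)); first by rewrite ler_wpM2r// ltW.
  by rewrite ler_wpM2l// ger1_powR// h0.
- left; rewrite (le_trans AK)// ler_peMr//.
  by rewrite -(powRr0 h) ler_powR.
Qed.

Theorem proposition3p3 (R : realType) (d : measure_display)
    (Omega : measurableType d) (P : probability Omega R)
    (T : R) (hT : 0 < T)
    (W : set (R * R) -> Omega -> R) (hW : white_noise P T W)
    (u : R -> R -> Omega -> R) (hu : mild_solution P T W u)
    (hmom : forall q : R, 2 <= q ->
       (ereal_sup [set 'E_P[fun w => (`|u z.1 z.2 w| `^ q)%R]
                  | z in space_time T] < +oo)%E)
    (p : R) (hp : 2 <= p) (beta : R) (hbeta : 2 < beta < 3) :
  exists2 C : R, 0 < C &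
    forall t x h : R, 0 <= t <= T -> 0 <= x < 1 -> 0 < h ->
      ('E_P[fun w => (`|drift u t (x + h) w - drift u t x w| `^ p)%R]
         <= (C * h `^ (2 * p / beta))%:E)%E.
Proof.
have [M1 M10 hM1] := ereal_sup_bound (hmom p hp).
have [M2 M20 hM2] : exists2 M, 0 <= M & forall z, space_time T z ->
    ('E_P[fun w => (`|u z.1 z.2 w| `^ (3 * p))%R] <= M%:E)%E.
  by apply: ereal_sup_bound; apply: hmom; lra.
pose M := 2 `^ p * (M1 + M2).
have M0 : 0 <= M by rewrite mulr_ge0 ?powR_ge0// addr_ge0.
pose K := 2 * T + 6 * Num.sqrt T.
have sT0 : 0 <= Num.sqrt T by exact: sqrtr_ge0.
have K0 : 0 < K by rewrite /K; lra.
exists (M * K `^ p + 1); first by rewrite ltr_wpDl// mulr_ge0// powR_ge0.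
move=> t x h /andP[t0 tT] x01 h0.
have hb : 0 <= 2 / beta <= 1.
  case/andP: hbeta => b2 b3; rewrite divr_ge0//=; last lra.
  by rewrite ler_pdivrMr; lra.
pose m := K * h `^ (2 / beta).
have m0 : 0 < m by rewrite mulr_gt0// powR_gt0.
have mu : measurable_fun (space_time t `*` [set: Omega])
    (fun z : (R * R) * Omega => u z.1.1 z.1.2 z.2).
  apply: measurable_funS hu.1.
    by apply: measurableX => //; exact: measurable_space_time.
  by move=> z [/= /(space_time_subset tT)].
pose k (z : R * R) :=
  heat_kernel (t - z.1) (x + h - z.2) - heat_kernel (t - z.1) (x - z.2).
have km : (\int[lebesgue2 R]_(z in space_time t) (`|k z|)%:E <= m%:E)%E.
  apply: (le_trans (integral_drift_kernel_dist _ _ t0)).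
  rewrite lee_fin addrAC subrr add0r gtr0_norm// mulrAC.
  have sqtT : Num.sqrt t <= Num.sqrt T by rewrite ler_wsqrtr.
  by apply: min_le_powR; rewrite ?(ltW K0)// /K; lra.
apply: (@le_trans _ _ (M * m `^ p)%:E).
  apply: (@moment_integral_le _ _ _ _ _
    (sigma_finite_lebesgue2_measure R) P (space_time t) k
    (fun z => allen_cahn (u z.1.1 z.1.2 z.2))) => //.
  - exact: measurable_space_time.
  - by apply: measurable_funB; exact: measurable_drift_kernel.
  - by apply: measurable_funB => //; exact: measurable_funX.
  - by apply: measurable_funB; exact: measurable_drift.
  - lra.
  - move=> z zt; have zT := space_time_subset tT zt.
    apply: allen_cahn_moment_le; [lra| |exact: hM1|exact: hM2].
    exact: (measurable_fun_sectionr (measurable_space_time T) hu.1 zT).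
  - have tT' : 0 <= t <= T by rewrite t0.
    have := mild_solution_integrable (x + h) hu tT'.
    apply: filterS2 (mild_solution_integrable x hu tT') => w ix ixh.
    exact: drift_dist_le.
rewrite lee_fin /m powRM ?powR_ge0 ?(ltW K0)// -powRrM.
have -> : 2 / beta * p = 2 * p / beta by ring.
rewrite mulrA ler_wpM2r ?powR_ge0//; lra.
Qed.
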